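(* Let $\mathcal F$ be a finite family of edge-colored cliques and let $\mathbb A$ be the relational structure associated with $\mathcal F$. If there is a minion homomorphism $\operatorname{Pol}(\mathbb A)\to\operatorname{id}$, then there is a minion homomorphism $\alpha\colon\operatorname{Pol}(\mathbb A)\to\operatorname{id}$ that collapses cut-homotopies, i.e., $\alpha(f)=\alpha(g)$ whenever $f$ and $g$ are cut-homotopic polymorphisms of $\mathbb A$.
   Context: **Structures.** A relational structure $\mathbb A=(A,R_1,\dots,R_q)$ has a domain $A$ and relations $R_i\subseteq A^{r_i}$, where each arity $r_i$ is a finite set and $A^{r_i}$ is the set of functions $r_i\to A$. A homomorphism from $\mathbb X=(X,S_1,\dots,S_q)$ to $\mathbb A$ (same signature) is a map $f\colon X\to A$ with $f\circ s\in R_i$ for all $s\in S_i$, $i\le q$. Products and powers $\mathbb A^r$ ($r$ a finite set) are the usual direct products, with relations defined coordinatewise. **The structure $\mathbb A$ and the hat.** Graphs are finite and undirected. The clique $K_n$ has $n$ vertices and an edge between each pair of distinct vertices (no loops); its edge set is identified with $\binom n2$, the set of two-element subsets of the vertex set. Given a finite family $\mathcal F$ of edge-colored cliques, $A$ denotes the set of colors occurring in $\mathcal F$. An edge-coloring of a loopless graph with colors from $A$ is $\mathcal F$-free if no member of $\mathcal F$ appears (up to color-preserving isomorphism) as an induced edge-colored subgraph. The structure $\mathbb A$ associated with $\mathcal F$ has domain $A$ and, for every $n$ such that $\mathcal F$ contains a clique of size $n$, a $\binom n2$-ary relation $R_n$ consisting of all $\mathcal F$-free edge-colorings $\binom n2\to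 A$ of $K_n$. For a graph $G$ (possibly with loops), $\hat G$ is the structure of the same signature whose domain is the set of edges (including loops) of $G$, where $vw=wv$, and whose $\binom n2$-ary relation consists of all maps $\binom n2\to\hat G$, $ij\mapsto\phi(i)\phi(j)$, where $\phi\colon K_n\to G$ is a graph homomorphism. **Minions.** A minion is a functor $\mathcal M$ from the category of finite sets to itself, $r\mapsto\mathcal M^{(r)}$; a minion homomorphism is a natural transformation. The minion $\operatorname{id}$ is the identity functor. The polymorphism minion $\operatorname{Pol}(\mathbb A)$ assigns to a finite set $r$ the set of homomorphisms $\mathbb A^r\to\mathbb A$ (the $r$-ary polymorphisms), and to a map $\sigma\colon r\to s$ the map $f\mapsto f\circ\sigma^*$, where $\sigma^*\colon\mathbb A^s\to\mathbb A^r$, $a\mapsto a\circ\sigma$. **Cut-homotopies.** $P_1$ is the graph with vertices $0,1$, loops $00$ and $11$, and the edge $01$. A cut-homotopy of polymorphisms is a homomorphism $h\colon\mathbb A^r\times\hat P_1\to\mathbb A$. Two $r$-ary polymorphisms $f,g$ are cut-homotopic if there is such an $h$ with $h(-,00)=f$ and $h(-,11)=g$. *)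

(* Defs.v *)
From HB Require Import structures.
From mathcomp Require Import all_boot.

Set Implicit Arguments.
Unset Strict Implicit.
Unset Printing Implicit Defensive.

(* Finite sets are [finType]s throughout; a tuple in X^r is a finite function
   [{ffun r -> X}] and a relation is a [{set {ffun r -> X}}]. *)

Record signature := Signature {
  symbol : finType;
  arity : symbol -> finType
}.

Record structure (S : signature) := Structure {
  dom :> finType;
  interp : forall i : symbol S, {set {ffun arity i -> dom}}
}.

Definition is_hom (S : signature) (X Y : structure S) (f : {ffun X -> Y}) :=
  [forall i : symbol S, forall s in interp X i,
     [ffun x => f (s x)] \in interp Y i].

Definition hom (S : signature) (X Y : structure S) : finType :=
  {f : {ffun X -> Y} | is_hom f}.

Definition product (S : signature) (X Y : structure S) : structure S :=
  @Structure S (X * Y)%type (fun i =>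
    [set s : {ffun arity i -> X * Y} |
       ([ffun x => (s x).1] \in interp X i) &&
       ([ffun x => (s x).2] \in interp Y i)]).

Definition power (S : signature) (X : structure S) (r : finType) : structure S :=
  @Structure S {ffun r -> X} (fun i =>
    [set s : {ffun arity i -> {ffun r -> X}} |
       [forall j : r, [ffun x => s x j] \in interp X i]]).

Record minion := Minion {
  mobj :> finType -> finType;
  mmap : forall r s : finType, (r -> s) -> mobj r -> mobj s;
  mmap_id : forall (r : finType) (x : mobj r), mmap (fun i => i) x = x;
  mmap_comp : forall (r s t : finType) (u : r -> s) (v : s -> t) (x : mobj r),
    mmap (fun i => v (u i)) x = mmap v (mmap u x)
}.

Record minion_hom (M N : minion) := MinionHom {
  mhom :> forall r : finType, M r -> N r;
  mhom_natural : forall (r s : finType) (u : r -> s) (x : M r),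
    mhom (mmap u x) = mmap u (mhom x)
}.

Definition id_minion : minion :=
  @Minion (fun r => r) (fun r s u => u)
    (fun r x => erefl) (fun r s t u v x => erefl).

Section Pol.
Variables (S : signature) (X : structure S).

Definition pol_map_fun (r s : finType) (u : r -> s) (f : hom (power X r) X) :
    {ffun power X s -> X} :=
  [ffun a : {ffun s -> X} => val f [ffun i => a (u i)]].

Lemma pol_map_is_hom (r s : finType) (u : r -> s) (f : hom (power X r) X) :
  is_hom (pol_map_fun u f).
Proof.
apply/forallP => i; apply/forall_inP => t; rewrite inE => /forallP tX.
have /forallP/(_ i)/forall_inP/(_ [ffun x => [ffun j => t x (u j)]]) := valP f.
have -> : [ffun x => pol_map_fun u f (t x)] =
    [ffun x => val f ([ffun x => [ffun j => t x (u j)]] x)].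
  by apply/ffunP => x; rewrite !ffunE.
apply; rewrite inE; apply/forallP => j.
suff -> : [ffun x => [ffun x => [ffun j => t x (u j)]] x j] =
  [ffun x => t x (u j)] by exact: tX.
by apply/ffunP => x; rewrite !ffunE.
Qed.

Definition pol_map (r s : finType) (u : r -> s) (f : hom (power X r) X) :
    hom (power X s) X :=
  exist _ (pol_map_fun u f) (pol_map_is_hom u f).

Lemma pol_map_id (r : finType) (f : hom (power X r) X) :
  pol_map (fun i => i) f = f.
Proof.
apply/val_inj/ffunP => a; rewrite ffunE; congr (val f _).
by apply/ffunP => i; rewrite ffunE.
Qed.

Lemma pol_map_comp (r s t : finType) (u : r -> s) (v : s -> t)
    (f : hom (power X r) X) :
  pol_map (fun i => v (u i)) f = pol_map v (pol_map u f).
Proof.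
apply/val_inj/ffunP => a; rewrite !ffunE; congr (val f _).
by apply/ffunP => i; rewrite !ffunE.
Qed.

Definition Pol : minion := Minion pol_map_id pol_map_comp.

End Pol.

Record graph := Graph {
  vertex : finType;
  adj : rel vertex;
  adj_sym : symmetric adj
}.

(* An edge vw is the set {v, w}; a loop vv is the singleton {v}. *)
Definition is_edge (G : graph) (e : {set vertex G}) :=
  [exists v, exists w, adj v w && (e == [set v; w])].

Definition edge (G : graph) : finType := {e : {set vertex G} | is_edge e}.

Lemma is_edge_of_adj (G : graph) (v w : vertex G) :
  adj v w -> is_edge [set v; w].
Proof. by move=> vw; apply/existsP; exists v; apply/existsP; exists w; rewrite vw eqxx. Qed.

Definition edge_of (G : graph) (v w : vertex G) (vw : adj v w) : edge G :=
  exist _ [set v; w] (is_edge_of_adj vw).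

Definition is_graph_hom (G H : graph) (p : {ffun vertex G -> vertex H}) :=
  [forall v, forall w, adj v w ==> adj (p v) (p w)].

Lemma clique_adj_sym (n : nat) : symmetric (fun v w : 'I_n => v != w).
Proof. by move=> v w; rewrite eq_sym. Qed.

Definition clique (n : nat) : graph := Graph (@clique_adj_sym n).

Lemma is_edge_clique (n : nat) (e : {set 'I_n}) :
  is_edge (G := clique n) e = (#|e| == 2).
Proof.
apply/existsP/cards2P => [[v /existsP[w /andP[vw /eqP->]]]|[v [w [vw ->]]]].
  by exists v, w.
by exists v; apply/existsP; exists w; rewrite /= vw eqxx.
Qed.

Definition coloring (C : Type) (G : graph) := {ffun edge G -> C}.

Record colored_clique (C : Type) := ColoredClique {
  csize : nat;
  ccol : coloring C (clique csize)
}.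

Section Family.
Variables (C : choiceType) (F : seq (colored_clique C)).

(* For an induced embedding p, the set p @: e is always an edge of G. *)
Definition appears (Q : colored_clique C) (G : graph) (c : coloring C G) :=
  [exists p : {ffun vertex (clique (csize Q)) -> vertex G},
     [&& injectiveb p,
         [forall v, forall w, adj (p v) (p w) == adj v w]
       & [forall e : edge (clique (csize Q)), forall e' : edge G,
            (val e' == p @: val e) ==> (c e' == ccol Q e)]]].

Definition free (G : graph) (c : coloring C G) :=
  all (fun Q => ~~ appears Q c) F.

Definition occurring : seq C := flatten [seq codom (ccol Q) | Q <- F].

Definition color : finType := seq_sub occurring.

Definition sizes : seq nat := [seq csize Q | Q <- F].

(* One symbol for each size n of a clique in F, of arity the edge set of K_n. *)
Definition family_sig : signature :=
  @Signature (seq_sub sizes) (fun n => edge (clique (val n))).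

Definition family_structure : structure family_sig :=
  @Structure family_sig color (fun n =>
    [set c : {ffun edge (clique (val n)) -> color} |
       free [ffun e => val (c e)]]).

(* The image p @: {i, j} is the edge p(i)p(j), a singleton if it is a loop. *)
Definition hat (G : graph) : structure family_sig :=
  @Structure family_sig (edge G) (fun n =>
    [set s : {ffun edge (clique (val n)) -> edge G} |
       [exists p : {ffun vertex (clique (val n)) -> vertex G},
          is_graph_hom p && [forall e, val (s e) == p @: val e]]]).

End Family.

Lemma P1_adj_sym : symmetric (fun _ _ : 'I_2 => true).
Proof. by []. Qed.

Definition P1 : graph := Graph P1_adj_sym.

Definition P1_00 : edge P1 := @edge_of P1 ord0 ord0 isT.
Definition P1_11 : edge P1 := @edge_of P1 ord_max ord_max isT.

Definition cut_homotopic (C : choiceType) (F : seq (colored_clique C))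
    (r : finType) (f g : Pol (family_structure F) r) :=
  exists h : hom (product (power (family_structure F) r) (hat F P1))
                 (family_structure F),
    (forall a, val h (a, P1_00) = val f a) /\
    (forall a, val h (a, P1_11) = val g a).

(* Main.v *)
Require Import Defs.
From HB Require Import structures.
From mathcomp Require Import all_boot.

(** Call a structure a core if each of its endomorphisms is injective. Minion
    homomorphisms and cut-homotopies pass along homomorphic equivalence, and a
    structure with a non-injective endomorphism is equivalent to the image of that
    endomorphism, so by induction on the size it is enough to treat a core [X]
    (lemmas [transport_hom], [homotopic_transport], theorem [structure_collapse]).
    Of the relations, only that their coordinates are the edges of cliques enters
    from there on.

    In a core the diagonal of a polymorphism is a permutation, and dividing by it
    makes the polymorphism idempotent. Given [alpha], the new homomorphism is
    [alpha] after this normalization. It collapses cut-homotopies. Otherwise some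
    homotopy joins idempotent polymorphisms with different images, and
    identifying variables makes it binary: operations [f], [k], [g] of which [f]
    and [g] are polymorphisms with images the first and the second coordinate,
    such that each relation is preserved when a set [U] of vertices of the clique
    is fixed and [g], [f], [k] are applied to edges inside [U], outside [U] and
    crossing.

    Let binary operations act on their second argument and compose them. With
    finitely many elements, large powers are idempotent, so one may arrange that
    [k] is idempotent and absorbs [g] on both sides ([sandwich]). Cutting off the
    vertices one by one then shows that [k] alone preserves the relations, as does
    the family with [f], or with [g], on a single edge and [k] on all others
    ([compatible_inner_l], [compatible_inner_r], [pol2_crossing]). In particular
    [k] is a polymorphism; its image differs from that of [f] or from that of [g].

    So there are idempotent polymorphisms with different images for which the
    relations are preserved when a single edge is switched from one to the other.
    Composition again makes the switches independent: two operations [q0], [q1]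
    with different images may be mixed according to any condition on their
    arguments ([no_single_switch_ordered]). This is impossible because, on
    idempotent operations, [alpha] respects composition ([alpha2_subst]) and hence
    is decided, on a suitable set of operations, by the value at a single argument
    ([no_free_mixing]). *)

Set Implicit Arguments.
Unset Strict Implicit.
Unset Printing Implicit Defensive.

(** * Iteration on a finite set *)

(** An orbit enters its cycle within [#|T|] steps, and the length of the cycle
    divides [#|T|`!]: one exponent turns every self-map into an idempotent. *)
Lemma iter_fact_idem (T : finType) (u : T -> T) (y : T) :
  iter #|T|`! u (iter #|T|`! u y) = iter #|T|`! u y.
Proof.
have /trajectP[i lti eqi] := looping_order u y.
have leo : order u y <= #|T| by apply: max_card.
have p0 : 0 < order u y - i by rewrite subn_gt0.
have [m eqm] : exists m, #|T|`! = m * (order u y - i).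
  by apply/dvdnP/dvdn_fact; rewrite p0 (leq_trans (leq_subr _ _)).
have leiD : i <= #|T|`!.
  apply: (leq_trans (ltnW lti)); apply: (leq_trans leo).
  have [->|n0] := posnP #|T|; first by [].
  by apply: dvdn_leq; rewrite ?fact_gt0 // dvdn_fact // n0 leqnn.
rewrite -iterD.
have per k : i <= k -> iter (k + (order u y - i)) u y = iter k u y.
  move=> lek; rewrite -{1}(subnK lek) -addnA (subnKC (ltnW lti)).
  by rewrite iterD eqi -iterD subnK.
have perm k : i <= k -> iter (k + m * (order u y - i)) u y = iter k u y.
  move=> lek; elim: m {eqm} => [|m IHm]; first by rewrite mul0n addn0.
  by rewrite mulSn [_ - _ + _]addnC addnA per ?IHm // (leq_trans lek) ?leq_addr.
by rewrite {2}eqm perm.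
Qed.

Lemma iter_fact_inj (T : finType) (u : T -> T) (y : T) :
  injective u -> iter #|T|`! u y = y.
Proof.
move=> inju; have injn n : injective (iter n u).
  by elim: n => [|n IHn] // a b /inju/IHn.
by apply: (injn #|T|`!); rewrite iter_fact_idem.
Qed.

Lemma iter_fixed (T : Type) (u : T -> T) (y : T) n : u y = y -> iter n u y = y.
Proof. by move=> uy; elim: n => //= n ->. Qed.

(** * Binary operations acting on their second argument *)

Definition comp2 (T : Type) (s t : T -> T -> T) : T -> T -> T :=
  fun x y => s x (t x y).

Definition pow2 (T : Type) (n : nat) (t : T -> T -> T) : T -> T -> T :=
  fun x y => iter n (t x) y.

Definition idempotent2 (T : Type) (t : T -> T -> T) := forall x, t x x = x.

Lemma idempotent2_comp (T : Type) (s t : T -> T -> T) :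
  idempotent2 s -> idempotent2 t -> idempotent2 (comp2 s t).
Proof. by move=> ids idt x; rewrite /comp2 idt ids. Qed.

Lemma idempotent2_pow (T : Type) n (t : T -> T -> T) :
  idempotent2 t -> idempotent2 (pow2 n t).
Proof. by move=> idt x; apply: iter_fixed. Qed.

Lemma pow2_fact_idem (T : finType) (t : T -> T -> T) x y :
  pow2 #|T|`! t x (pow2 #|T|`! t x y) = pow2 #|T|`! t x y.
Proof. exact: iter_fact_idem. Qed.

(** * Compatible families of binary operations *)

Lemma mem_ext (aT rT : finType) (R : {set {ffun aT -> rT}}) (s t : {ffun aT -> rT}) :
  s \in R -> s =1 t -> t \in R.
Proof. by move=> sR /ffunP <-. Qed.

Section Compatible.
Variables (S : signature) (X : structure S).

(** One operation per coordinate of the relation: a polymorphism of the relation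
    viewed as a relation between as many sorts as it has coordinates. *)
Definition compatible (i : symbol S) (H : arity i -> X -> X -> X) :=
  forall s t, s \in interp X i -> t \in interp X i ->
    [ffun e => H e (s e) (t e)] \in interp X i.

Definition pol2 (t : X -> X -> X) := forall i, compatible (i := i) (fun _ => t).

Lemma compatible_ext i (H H' : arity i -> X -> X -> X) :
  (forall e x y, H e x y = H' e x y) -> compatible H -> compatible H'.
Proof.
move=> eqH cH s t sR tR; apply: mem_ext (cH _ _ sR tR) _ => e.
by rewrite !ffunE.
Qed.

Lemma compatible_subst i (H H1 H2 : arity i -> X -> X -> X) :
  compatible H -> compatible H1 -> compatible H2 ->
  compatible (fun e x y => H e (H1 e x y) (H2 e x y)).
Proof.
move=> cH cH1 cH2 s t sR tR; apply: mem_ext (cH _ _ (cH1 _ _ sR tR) (cH2 _ _ sR tR)) _ => e.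
by rewrite !ffunE.
Qed.

Lemma compatible_fst i : compatible (i := i) (fun _ x _ => x).
Proof. by move=> s t sR _; apply: mem_ext sR _ => e; rewrite ffunE. Qed.

Lemma compatible_snd i : compatible (i := i) (fun _ _ y => y).
Proof. by move=> s t _ tR; apply: mem_ext tR _ => e; rewrite ffunE. Qed.

Lemma compatible_comp i (H H' : arity i -> X -> X -> X) :
  compatible H -> compatible H' -> compatible (fun e => comp2 (H e) (H' e)).
Proof. by move=> cH cH'; apply: compatible_subst cH (@compatible_fst i) cH'. Qed.

Lemma compatible_pow i n (H : arity i -> X -> X -> X) :
  compatible H -> compatible (fun e => pow2 n (H e)).
Proof.
move=> cH; elim: n => [|n IHn]; first exact: compatible_snd.
by apply: compatible_ext (compatible_comp cH IHn).
Qed.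

Lemma pol2_comp s t : pol2 s -> pol2 t -> pol2 (comp2 s t).
Proof. by move=> ps pt i; apply: compatible_comp (ps i) (pt i). Qed.

Lemma pol2_pow n t : pol2 t -> pol2 (pow2 n t).
Proof. by move=> pt i; apply: compatible_pow (pt i). Qed.

Lemma pol2_subst s t1 t2 : pol2 s -> pol2 t1 -> pol2 t2 ->
  pol2 (fun x y => s (t1 x y) (t2 x y)).
Proof. by move=> ps p1 p2 i; apply: compatible_subst (ps i) (p1 i) (p2 i). Qed.

End Compatible.

(** * Collapsing the crossing operation of a cut *)

Section Cut.
Variables (C : choiceType) (F : seq (colored_clique C)).
Variable X : structure (family_sig F).

Lemma card_clique_edge (n : nat) (e : edge (clique n)) : #|val e| = 2.
Proof. by apply/eqP; rewrite -is_edge_clique; apply: valP. Qed.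

Lemma sub_clique_edge (n : nat) (e e' : edge (clique n)) :
  (val e \subset val e') = (e == e').
Proof.
apply/idP/eqP => [sub|-> //]; apply/val_inj/eqP.
by rewrite eqEcard sub !card_clique_edge.
Qed.

Definition cut_op (f k g : X -> X -> X) (n : nat) (U e : {set 'I_n}) :=
  if e \subset U then g else if [disjoint e & U] then f else k.

(** The triple [f], [k], [g] is what a homotopy of binary operations amounts to:
    its values at the edges 00, 01 and 11 of [P1]. *)
Definition cut_compatible (f k g : X -> X -> X) :=
  forall (i : symbol (family_sig F)) (U : {set 'I_(val i)}),
    compatible (X := X) (i := i) (fun e : edge (clique (val i)) => cut_op f k g U (val e)).

Lemma cut_compatible_pow n f k g :
  cut_compatible f k g -> cut_compatible (pow2 n f) (pow2 n k) (pow2 n g).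
Proof.
move=> h i U; apply: compatible_ext (compatible_pow n (h i U)) => e x y.
by rewrite /cut_op; case: ifP => // _; case: ifP.
Qed.

Lemma cut_compatible_comp f k g f' k' g' :
  cut_compatible f k g -> cut_compatible f' k' g' ->
  cut_compatible (comp2 f f') (comp2 k k') (comp2 g g').
Proof.
move=> h h' i U; apply: compatible_ext (compatible_comp (h i U) (h' i U)) => e x y.
by rewrite /cut_op; case: ifP => // _; case: ifP.
Qed.

(** The ends of a homotopy are polymorphisms: take the cuts with all vertices on
    one side. *)
Lemma cut_compatible_pol_r f k g : cut_compatible f k g -> pol2 g.
Proof.
by move=> h i; apply: compatible_ext (h i setT) => e x y; rewrite /cut_op subsetT.
Qed.

Lemma cut_compatible_pol_l f k g : cut_compatible f k g -> pol2 f.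
Proof.
move=> h i; apply: compatible_ext (h i set0) => e x y.
rewrite /cut_op subset0 -cards_eq0 card_clique_edge /=.
by rewrite disjoint_sym disjoints_subset sub0set.
Qed.

Lemma cut_compatible_const t : pol2 t -> cut_compatible t t t.
Proof.
by move=> pt i U; apply: compatible_ext (pt i) => e x y; rewrite /cut_op;
  case: ifP => // _; case: ifP.
Qed.

Section Absorb.
Variables f k g : X -> X -> X.
Hypothesis h : cut_compatible f k g.
Hypothesis kk : forall x y, k x (k x y) = k x y.
Hypothesis gg : forall x y, g x (g x y) = g x y.
Hypothesis kg : forall x y, k x (g x y) = k x y.
Hypothesis gk : forall x y, g x (k x y) = k x y.
Hypothesis fg : forall x y, f x (g x y) = f x y.

(** Cutting off one vertex at a time never puts [f] on an edge, and [k] absorbs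
    [g]: the composite of the cuts at the vertices outside [U] is [k] on each edge
    that was ever cut. *)
Lemma compatible_inner_r (i : symbol (family_sig F)) (U : {set 'I_(val i)}) :
  compatible (X := X) (i := i)
    (fun e : edge (clique (val i)) => if val e \subset U then g else k).
Proof.
suff H (l : seq 'I_(val i)) : compatible (X := X) (i := i)
    (fun e : edge (clique (val i)) => if has (mem (val e)) l then k else g).
  apply: compatible_ext (H (enum (~: U))) => e x y.
  have -> : (val e \subset U) = ~~ has (mem (val e)) (enum (~: U)).
    rewrite -all_predC; apply/subsetP/allP => [sub v|sub v ve].
      by rewrite mem_enum inE; apply: contra => /sub.
    by apply: contraLR ve => vU; apply: sub; rewrite mem_enum inE.
  by case: has.
elim: l => [|v l IHl]; first exact: cut_compatible_pol_r h i.
apply: compatible_ext (compatible_comp (h (~: [set v])) IHl) => e x y.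
have e1 : (val e \subset [set v]) = false.
  by apply/negP => /subset_leq_card; rewrite card_clique_edge cards1.
have eC : (val e \subset ~: [set v]) = (v \notin val e).
  by rewrite -disjoints_subset disjoint_sym disjoints1.
rewrite /= /comp2 /cut_op eC disjoints_subset setCK e1.
by case: (v \in val e) => /=; case: has; rewrite ?kk ?kg ?gk ?gg.
Qed.

(** No edge lies inside the empty set. *)
Lemma pol2_crossing : pol2 k.
Proof.
move=> i; apply: compatible_ext (compatible_inner_r set0) => e x y.
by rewrite subset0 -cards_eq0 card_clique_edge.
Qed.

(** The cut around [U] puts [f] inside [U] and possibly [g] outside; composing it
    with the previous family turns every [g] outside into [k]. *)
Lemma compatible_inner_l (i : symbol (family_sig F)) (U : {set 'I_(val i)}) :
  compatible (X := X) (i := i)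
    (fun e : edge (clique (val i)) => if val e \subset U then f else k).
Proof.
apply: compatible_ext (compatible_comp (h (~: U)) (compatible_inner_r U)) => e x y.
rewrite /comp2 /cut_op disjoints_subset setCK.
case eU: (val e \subset U); last by case: ifP => _; rewrite ?kk ?gk.
case: ifP => [eC|_]; last by rewrite fg.
have : val e \subset set0 by rewrite -(setICr U) subsetI eU eC.
by rewrite subset0 -cards_eq0 card_clique_edge.
Qed.

End Absorb.

Local Notation D := (#|X|`!).

(** Powers make [g] idempotent; conjugating by it and taking powers again makes
    the crossing operation an idempotent that absorbs [g]. *)
Definition sandwich (g t : X -> X -> X) :=
  pow2 D (comp2 (pow2 D g) (comp2 (pow2 D t) (pow2 D g))).

Lemma sandwich_idem g t x y : sandwich g t x (sandwich g t x y) = sandwich g t x y.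
Proof. exact: pow2_fact_idem. Qed.

Lemma sandwich_absorb_r g t x y : sandwich g t x (pow2 D g x y) = sandwich g t x y.
Proof.
rewrite /sandwich; have := @pow2_fact_idem _ g; set G := pow2 D g; set T := pow2 D t.
by move=> GG; rewrite /(pow2 D) -(prednK (fact_gt0 #|X|)) !iterSr /comp2 GG.
Qed.

Lemma sandwich_absorb_l g t x y : pow2 D g x (sandwich g t x y) = sandwich g t x y.
Proof.
rewrite /sandwich; have := @pow2_fact_idem _ g; set G := pow2 D g; set T := pow2 D t.
by move=> GG; rewrite /(pow2 D) -(prednK (fact_gt0 #|X|)) !iterS /comp2 GG.
Qed.

Lemma sandwich_self g x y : sandwich g g x y = pow2 D g x y.
Proof.
rewrite /sandwich; have := @pow2_fact_idem _ g; set G := pow2 D g => GG.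
rewrite /(pow2 D) -(prednK (fact_gt0 #|X|)); elim: _.-1 => [|n IHn].
  by rewrite /= /comp2 !GG.
by rewrite iterS IHn /comp2 !GG.
Qed.

Lemma cut_compatible_sandwich f k g : cut_compatible f k g ->
  cut_compatible (sandwich g f) (sandwich g k) (pow2 D g).
Proof.
move=> h; have hD := cut_compatible_pow D h.
have hg := cut_compatible_const (pol2_pow D (cut_compatible_pol_r h)).
have hs := cut_compatible_pow D
  (cut_compatible_comp hg (cut_compatible_comp hD hg)).
move=> i U; apply: compatible_ext (hs i U) => e x y.
by rewrite /cut_op; case: ifP => // _; rewrite -/(sandwich g g) sandwich_self.
Qed.

End Cut.

(** * Minion homomorphisms to the identity on idempotent binary polymorphisms *)

Lemma is_homP (S : signature) (X Y : structure S) (f : {ffun X -> Y}) :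
  reflect (forall i (s : {ffun arity i -> X}), s \in interp X i ->
             [ffun e => f (s e)] \in interp Y i)
          (is_hom f).
Proof. by apply: (iffP forallP) => h i; apply/forall_inP; apply: h. Qed.

Lemma is_hom_powerP (S : signature) (X Y : structure S) (r : finType)
    (f : {ffun power X r -> Y}) :
  reflect (forall i (s : r -> {ffun arity i -> X}),
             (forall j, s j \in interp X i) ->
             [ffun e => f [ffun j => s j e]] \in interp Y i)
          (is_hom f).
Proof.
apply: (iffP (is_homP _)) => h i s sR.
  have sP : [ffun e => [ffun j => s j e]] \in interp (power X r) i.
    rewrite inE; apply/forallP => j; apply: mem_ext (sR j) _ => e.
    by rewrite !ffunE.
  by apply: mem_ext (h i _ sP) _ => e; rewrite !ffunE.
move: sR; rewrite inE => /forallP sR.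
apply: mem_ext (h i _ sR) _ => e; rewrite !ffunE; congr (f _).
by apply/ffunP => j; rewrite !ffunE.
Qed.

Section Binary.
Variables (S : signature) (X : structure S).
Variable alpha : minion_hom (Pol X) id_minion.

Definition pol_of (r : finType) (f : {ffun power X r -> X}) (hf : is_hom f) : Pol X r :=
  exist (fun g => is_true (is_hom g)) f hf.

Definition op2 (t : X -> X -> X) : {ffun power X bool -> X} :=
  [ffun a : {ffun bool -> X} => t (a false) (a true)].

(** The two coordinates of a binary operation are [false] and [true]; the value
    on operations that are not polymorphisms is a dummy. *)
Definition alpha2 (t : X -> X -> X) : bool :=
  if insub (op2 t) : option (hom (power X bool) X) is Some f
  then alpha bool f else false.

Lemma alpha2E (f : Pol X bool) (t : X -> X -> X) :
  (forall a : {ffun bool -> X}, val f a = t (a false) (a true)) ->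
  alpha2 t = alpha bool f.
Proof.
move=> ft; have -> : alpha2 t = alpha2 (fun x y => val f [ffun b => if b then y else x]).
  rewrite /alpha2; congr (if insub _ is Some _ then _ else _).
  by apply/ffunP => a; rewrite !ffunE ft !ffunE.
rewrite /alpha2 (_ : op2 _ = val f) ?valK //.
apply/ffunP => a; rewrite ffunE; congr (val f _).
by apply/ffunP => -[]; rewrite ffunE.
Qed.

Lemma alpha2_ext (s t : X -> X -> X) :
  (forall x y, s x y = t x y) -> alpha2 s = alpha2 t.
Proof.
move=> st; rewrite /alpha2 (_ : op2 s = op2 t) //.
by apply/ffunP => a; rewrite !ffunE st.
Qed.

Lemma alpha2_minor (r : finType) (f : Pol X r) (u : r -> bool) (t : X -> X -> X) :
  (forall x y, val f [ffun i => if u i then y else x] = t x y) ->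
  alpha2 t = u (alpha r f).
Proof.
move=> ft; rewrite (alpha2E (f := mmap u f)) ?mhom_natural // => a.
rewrite ffunE -ft; congr (val f _); apply/ffunP => i; rewrite !ffunE.
by case: (u i).
Qed.

Lemma is_hom_proj : is_hom (X := power X unit) (Y := X)
  [ffun a : {ffun unit -> X} => a tt].
Proof.
apply/is_hom_powerP => i s sR.
by apply: mem_ext (sR tt) _ => e; rewrite !ffunE.
Qed.

Definition proj1_pol : Pol X unit := pol_of is_hom_proj.

Lemma alpha2_fst : alpha2 (fun x _ => x) = false.
Proof.
by rewrite (@alpha2_minor _ proj1_pol (fun _ => false)) // => x y; rewrite !ffunE.
Qed.

Lemma alpha2_snd : alpha2 (fun _ y => y) = true.
Proof.
by rewrite (@alpha2_minor _ proj1_pol (fun _ => true)) // => x y; rewrite !ffunE.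
Qed.

(** By idempotence [s], [t1] and [t2] are all minors of the 8-ary operation [s]
    of two copies of [t1] of two copies of [t2], and so is [s (t1, t2)]: the image
    of that operation is the triple of the three images. *)
Lemma alpha2_subst (s t1 t2 : X -> X -> X) :
  pol2 s -> pol2 t1 -> pol2 t2 ->
  idempotent2 s -> idempotent2 t1 -> idempotent2 t2 ->
  alpha2 (fun x y => s (t1 x y) (t2 x y)) = if alpha2 s then alpha2 t2 else alpha2 t1.
Proof.
move=> ps p1 p2 ids id1 id2.
pose v (a : {ffun bool * (bool * bool) -> X}) p q := t2 (a (p, (q, false))) (a (p, (q, true))).
pose w (a : {ffun bool * (bool * bool) -> X}) p := t1 (v a p false) (v a p true).
have hf : is_hom (X := power X (bool * (bool * bool))%type) (Y := X)
    [ffun a : {ffun bool * (bool * bool) -> X} => s (w a false) (w a true)].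
  apply/is_hom_powerP => i z zR.
  have vR p q := p2 i _ _ (zR (p, (q, false))) (zR (p, (q, true))).
  have wR p := p1 i _ _ (vR p false) (vR p true).
  apply: mem_ext (ps i _ _ (wR false) (wR true)) _ => e.
  by rewrite !ffunE /w /v !ffunE.
pose f : Pol X (bool * (bool * bool))%type := pol_of hf.
have -> : alpha2 s = (alpha _ f).1.
  apply: (alpha2_minor (u := fst)) => x y.
  by rewrite ffunE /w /v !ffunE /= !(id1, id2).
have -> : alpha2 t1 = (alpha _ f).2.1.
  apply: (alpha2_minor (u := fun p => p.2.1)) => x y.
  by rewrite ffunE /w /v !ffunE /= !(id2, ids).
have -> : alpha2 t2 = (alpha _ f).2.2.
  apply: (alpha2_minor (u := fun p => p.2.2)) => x y.
  by rewrite ffunE /w /v !ffunE /= !(id1, ids).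
apply: (alpha2_minor (u := fun p => if p.1 then p.2.2 else p.2.1)) => x y.
by rewrite ffunE /w /v !ffunE /= !(id1, id2).
Qed.

Lemma alpha2_comp s t : pol2 s -> pol2 t -> idempotent2 s -> idempotent2 t ->
  alpha2 (comp2 s t) = alpha2 s && alpha2 t.
Proof.
move=> ps pt ids idt; have := alpha2_subst ps (@compatible_fst _ X) pt ids _ idt.
by rewrite alpha2_fst => ->.
Qed.

Lemma alpha2_pow n t : 0 < n -> pol2 t -> idempotent2 t ->
  alpha2 (pow2 n t) = alpha2 t.
Proof.
move=> n0 pt idt; rewrite -(prednK n0); elim: n.-1 => [|m IHm] //.
rewrite (@alpha2_ext _ (comp2 t (pow2 m.+1 t))) // alpha2_comp ?IHm ?andbb //.
  exact: pol2_pow.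
exact: idempotent2_pow.
Qed.

Lemma alpha2_flip t : pol2 t -> idempotent2 t ->
  alpha2 (fun x y => t y x) = ~~ alpha2 t.
Proof.
move=> pt idt.
rewrite (alpha2_subst pt (@compatible_snd _ X) (@compatible_fst _ X)) //.
by rewrite alpha2_fst alpha2_snd; case: alpha2.
Qed.

(** * Two operations with different images cannot be mixed freely *)

(** Take operations [t0], [t1] with distinct images that agree on as many
    arguments as possible: on the operations that agree with them there, the image
    is determined by the value at any further argument [z]. Choose the mixture
    that is [q0] only at [(t0 z, t1 z)]. By their values at [z], the
    composites of the mixture with [(t0, t1)] and with [(t1, t0)] both have the
    image of [t0]; by [alpha2_subst] one of them has that of [t1]. *)
Lemma no_free_mixing (q0 q1 : X -> X -> X) :
  pol2 q0 -> pol2 q1 -> idempotent2 q0 -> idempotent2 q1 ->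
  alpha2 q0 = false -> alpha2 q1 = true ->
  (forall d : X -> X -> bool, pol2 (fun x y => if d x y then q0 x y else q1 x y)) ->
  False.
Proof.
move=> p0 p1 id0 id1 a0 a1 mix.
pose agree (Z : {set X * X}) (s t : X -> X -> X) :=
  forall z, z \in Z -> s z.1 z.2 = t z.1 z.2.
suff H n (Z : {set X * X}) t0 t1 : #|~: Z| <= n ->
    pol2 t0 -> pol2 t1 -> idempotent2 t0 -> idempotent2 t1 -> agree Z t0 t1 ->
    alpha2 t0 = false -> alpha2 t1 = true -> False.
  by apply: (H #|~: set0| set0 q0 q1) => // z; rewrite inE.
elim: n Z t0 t1 => [|n IHn] Z t0 t1 leZ pt0 pt1 it0 it1 ag at0 at1.
all: have [ZT|[z zZ]] := set_0Vmem (~: Z).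
- have Zall z : z \in Z by rewrite -[Z]setCK ZT setC0 inE.
  by have := @alpha2_ext t0 t1 (fun x y => ag (x, y) (Zall _)); rewrite at0 at1.
- by move: leZ; rewrite leqn0 cards_eq0 => /eqP Z0; rewrite Z0 inE in zZ.
- have Zall z : z \in Z by rewrite -[Z]setCK ZT setC0 inE.
  by have := @alpha2_ext t0 t1 (fun x y => ag (x, y) (Zall _)); rewrite at0 at1.
have eqa s t : pol2 s -> pol2 t -> idempotent2 s -> idempotent2 t ->
    agree Z s t -> s z.1 z.2 = t z.1 z.2 -> alpha2 s = alpha2 t.
  move=> pols polt ids idt agst eqz.
  have leZ' : #|~: (z |: Z)| <= n.
    rewrite setCU setIC -setDE -ltnS; apply: leq_trans leZ.
    by rewrite [X in _ < X](cardsD1 z) zZ.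
  have agz u v : agree Z u v -> u z.1 z.2 = v z.1 z.2 -> agree (z |: Z) u v.
    by move=> aguv equv z'; rewrite !inE => /orP[/eqP ->|/aguv].
  case as_: (alpha2 s); case at_: (alpha2 t) => //; exfalso.
    by apply: (IHn (z |: Z) t s) => //; apply: agz => // z' /agst.
  by apply: (IHn (z |: Z) s t) => //; apply: agz.
pose a := t0 z.1 z.2; pose b := t1 z.1 z.2.
have neab : a != b.
  by apply/eqP => eqab; have := eqa t0 t1 pt0 pt1 it0 it1 ag eqab; rewrite at0 at1.
pose tau x y := if (x == a) && (y == b) then q0 x y else q1 x y.
have ptau : pol2 tau := mix (fun x y => (x == a) && (y == b)).
have itau : idempotent2 tau by move=> x; rewrite /tau; case: ifP.
have E1 : alpha2 (fun x y => tau (t0 x y) (t1 x y)) =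
    alpha2 (fun x y => q0 (t0 x y) (t1 x y)).
  apply: eqa; try exact: pol2_subst.
  - by move=> x; rewrite it0 it1.
  - by move=> x; rewrite it0 it1.
  - by move=> z' z'Z; rewrite (ag _ z'Z) itau id0.
  - by rewrite /tau !eqxx.
have E2 : alpha2 (fun x y => tau (t1 x y) (t0 x y)) =
    alpha2 (fun x y => q1 (t1 x y) (t0 x y)).
  apply: eqa; try exact: pol2_subst.
  - by move=> x; rewrite it0 it1.
  - by move=> x; rewrite it0 it1.
  - by move=> z' z'Z; rewrite (ag _ z'Z) itau id1.
  - by rewrite /tau -/a -/b (negPf neab) andbF.
have S01 u : pol2 u -> idempotent2 u -> alpha2 (fun x y => u (t0 x y) (t1 x y)) = alpha2 u.
  by move=> pu iu; rewrite (alpha2_subst pu pt0 pt1) // at0 at1; case: alpha2.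
have S10 u : pol2 u -> idempotent2 u -> alpha2 (fun x y => u (t1 x y) (t0 x y)) = ~~ alpha2 u.
  by move=> pu iu; rewrite (alpha2_subst pu pt1 pt0) // at0 at1; case: alpha2.
move: E1 E2; rewrite (S01 _ ptau) // (S01 _ p0) // (S10 _ ptau) // (S10 _ p1) //.
by rewrite a0 a1 => ->.
Qed.

End Binary.

(** * Switching an operation at a single coordinate *)

Section Switch.
Variables (S : signature) (X : structure S).
Variable alpha : minion_hom (Pol X) id_minion.

Local Notation D := (#|X|`!).

(** Composing the switches for several coordinates independently, any set of
    coordinates can be switched, in particular the set of those whose arguments
    satisfy a given condition: this is free mixing. *)
Lemma no_single_switch_ordered (s t : X -> X -> X) :
  pol2 s -> pol2 t -> idempotent2 s -> idempotent2 t ->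
  alpha2 alpha t = false -> alpha2 alpha s = true ->
  (forall (i : symbol S) (e0 : arity i),
     compatible (X := X) (fun e => if e == e0 then t else s)) ->
  False.
Proof.
move=> ps pt ids idt at_ as_ switch.
(* The image of [s] is the second coordinate, so padding with powers of [s] does
   not change the image of [t]. Between idempotents [q], the power of
   [s] in [t'] completes the unswitched [s] to [q]. *)
pose q := pow2 D s; pose t' := comp2 t (pow2 D.-1 s).
pose p := comp2 q (comp2 t' q).
have pq : pol2 q by apply: pol2_pow.
have iq : idempotent2 q by apply: idempotent2_pow.
have pt' : pol2 t' by apply/pol2_comp/pol2_pow.
have it' : idempotent2 t' by apply/idempotent2_comp/idempotent2_pow.
have ptq : pol2 (comp2 t' q) by apply: pol2_comp.
have itq : idempotent2 (comp2 t' q) by apply: idempotent2_comp.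
have pp : pol2 p by apply: pol2_comp.
have ip : idempotent2 p by apply: idempotent2_comp.
have aq : alpha2 alpha q by rewrite alpha2_pow ?fact_gt0.
have ap : alpha2 alpha p = false.
  have at' : alpha2 alpha t' = false.
    rewrite (alpha2_comp alpha pt (pol2_pow _ ps)) ?at_ //.
    exact: idempotent2_pow.
  by rewrite (alpha2_comp alpha pq ptq) // (alpha2_comp alpha pt' pq) // at' andbF.
have qq x y : q x (q x y) = q x y by apply: pow2_fact_idem.
have sq x y : s x (pow2 D.-1 s x y) = q x y.
  by rewrite /q /pow2 -iterS prednK ?fact_gt0.
have single (i : symbol S) (e0 : arity i) :
    compatible (X := X) (fun e => if e == e0 then p else q).
  have c := compatible_comp (switch i e0) (pol2_pow D.-1 ps (i := i)).
  have {}c := compatible_comp (pq i) (compatible_comp c (pq i)).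
  apply: compatible_ext c => e x y.
  by rewrite /p /t' /comp2; case: ifP => // _; rewrite sq !qq.
have many (i : symbol S) (l : seq (arity i)) :
    compatible (X := X) (fun e => if e \in l then p else q).
  elim: l => [|e0 l IHl]; first exact: pq.
  have [e0l|e0l] := boolP (e0 \in l).
    apply: compatible_ext IHl => e x y; rewrite inE.
    by case: eqP => [->|//]; rewrite e0l.
  apply: compatible_ext (compatible_comp (single i e0) IHl) => e x y.
  rewrite inE /comp2; case: eqP => [->|_] /=.
    by rewrite (negPf e0l) /p /comp2 qq.
  by case: ifP => _; rewrite ?qq // /p /comp2 qq.
apply: (@no_free_mixing _ _ alpha p q) => // d i a b aR bR.
apply: mem_ext (many i (enum [pred e | d (a e) (b e)]) _ _ aR bR) _ => e.
by rewrite !ffunE mem_enum inE; case: ifP.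
Qed.

(** When the images are in the other order, exchanging the two arguments of all
    operations reverses them. *)
Lemma no_single_switch (s t : X -> X -> X) :
  pol2 s -> pol2 t -> idempotent2 s -> idempotent2 t ->
  (forall (i : symbol S) (e0 : arity i),
     compatible (X := X) (fun e => if e == e0 then t else s)) ->
  alpha2 alpha t = alpha2 alpha s.
Proof.
move=> ps pt ids idt switch.
case at_: (alpha2 alpha t); case as_: (alpha2 alpha s) => //; exfalso; last first.
  exact: (no_single_switch_ordered ps pt).
have pflip u : pol2 u -> pol2 (X := X) (fun x y => u y x).
  by move=> pu i a b aR bR; apply: pu.
apply: (@no_single_switch_ordered (fun x y => s y x) (fun x y => t y x)) => //.
- exact: pflip.
- exact: pflip.
- by rewrite alpha2_flip ?at_.
- by rewrite alpha2_flip ?as_.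
move=> i e0 a b aR bR; apply: mem_ext (switch i e0 b a bR aR) _ => e.
by rewrite !ffunE; case: ifP.
Qed.

End Switch.

(** * Normalizing homotopies in a core *)

Section Core.
Variables (C : choiceType) (F : seq (colored_clique C)).
Variable X : structure (family_sig F).

Local Notation D := (#|X|`!).

Section Alpha.
Variable alpha : minion_hom (Pol X) id_minion.

Lemma cut_compatible_sym f k g :
  cut_compatible (X := X) f k g -> cut_compatible (X := X) g k f.
Proof.
move=> h i U; apply: compatible_ext (h i (~: U)) => e x y.
rewrite /cut_op disjoints_subset setCK -disjoints_subset.
have [eU|//] := boolP (val e \subset U); case: ifP => // dU.
have : val e \subset set0 by rewrite -(setICr U) subsetI eU -disjoints_subset.
by rewrite subset0 -cards_eq0 card_clique_edge.
Qed.

(** After the sandwich, [E] can be switched to [G] and to [L] on single edges, so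
    the images of [G] and [L] both equal that of [E]; but they are those of [g] and
    [f], as the image of a composite is the second coordinate exactly if those of
    all factors are. *)
Lemma cut_idempotent_alpha2 f k g : cut_compatible (X := X) f k g ->
  idempotent2 f -> idempotent2 k -> idempotent2 g -> alpha2 alpha f = alpha2 alpha g.
Proof.
wlog [af ag] : f g / alpha2 alpha f = false /\ alpha2 alpha g = true.
  move=> W h idf idk idg; case af: (alpha2 alpha f); case ag: (alpha2 alpha g) => //.
    by rewrite -af -ag (W g f) //; apply: cut_compatible_sym.
  by rewrite -af -ag; apply: W.
move=> h idf idk idg; exfalso.
have pf := cut_compatible_pol_l h; have pg := cut_compatible_pol_r h.
have hs := cut_compatible_sandwich h.
pose G := pow2 D g; pose E := sandwich g k; pose L := sandwich g f.
have idG : idempotent2 G by apply: idempotent2_pow.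
have idS u : idempotent2 u -> idempotent2 (sandwich g u).
  by move=> iu; apply/idempotent2_pow/idempotent2_comp/idempotent2_comp => //;
    apply: idempotent2_pow.
have pG : pol2 (X := X) G by apply: pol2_pow.
have pL : pol2 (X := X) L by apply: cut_compatible_pol_l hs.
have EE := sandwich_idem g k; have GG := @pow2_fact_idem _ g.
have EG := sandwich_absorb_r g k; have GE := sandwich_absorb_l g k.
have LG := sandwich_absorb_r g f.
have pE : pol2 (X := X) E by apply: (pol2_crossing hs EE GG EG GE).
have aG : alpha2 alpha G = true by rewrite alpha2_pow ?fact_gt0.
have aL : alpha2 alpha L = false.
  rewrite alpha2_pow ?fact_gt0 //; last 2 first.
  - by do 2!apply: pol2_comp => //; apply: pol2_pow.
  - by do 2!apply: idempotent2_comp => //; apply: idempotent2_pow.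
  rewrite alpha2_comp //; last 2 first.
  - by apply: pol2_comp => //; apply: pol2_pow.
  - by apply: idempotent2_comp => //; apply: idempotent2_pow.
  rewrite alpha2_comp ?alpha2_pow ?fact_gt0 ?af ?andbF //.
    exact: pol2_pow.
  exact: idempotent2_pow.
have aGE : alpha2 alpha G = alpha2 alpha E.
  apply: no_single_switch => //; first exact: idS.
  move=> i e0; apply: compatible_ext (compatible_inner_r hs EE GG EG GE (val e0)) => e x y.
  by rewrite sub_clique_edge.
have aLE : alpha2 alpha L = alpha2 alpha E.
  apply: no_single_switch => //; try exact: idS.
  move=> i e0; apply: compatible_ext (compatible_inner_l hs EE GG EG GE LG (val e0)) => e x y.
  by rewrite sub_clique_edge.
by have := aG; rewrite aGE -aLE aL.
Qed.

End Alpha.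

Hypothesis coreX : forall u : hom X X, injective (val u).

Lemma pol2_diag_inj (t : X -> X -> X) : pol2 t -> injective (fun x => t x x).
Proof.
move=> pt; have ht : is_hom [ffun x => t x x].
  apply/is_homP => i s sR; apply: mem_ext (pt i s s sR sR) _ => e.
  by rewrite !ffunE.
have := coreX (u := exist (fun u => is_true (is_hom u)) _ ht).
by move=> inj x y eqxy; apply: inj; rewrite !ffunE.
Qed.

(** The diagonals of a homotopy form a homotopy of unary operations. Its ends are
    permutations, whose [D]-th powers are the identity, so that the crossing
    operation of the sandwich is a power of the given one; being an endomorphism,
    it is injective. *)
Lemma cut_diag_inj f k g :
  cut_compatible (X := X) f k g -> injective (fun x => k x x).
Proof.
move=> h; have hd : cut_compatible (X := X)
    (fun _ y => f y y) (fun _ y => k y y) (fun _ y => g y y).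
  move=> i U; apply: compatible_ext (compatible_subst (h i U)
    (@compatible_snd _ X i) (@compatible_snd _ X i)) => e x y.
  by rewrite /cut_op; case: ifP => // _; case: ifP.
have pE := pol2_crossing (cut_compatible_sandwich hd) (sandwich_idem _ _)
  (@pow2_fact_idem _ _) (sandwich_absorb_r _ _) (sandwich_absorb_l _ _).
have inj := pol2_diag_inj pE.
have injg := pol2_diag_inj (cut_compatible_pol_r h).
have sE z : sandwich (fun _ y => g y y) (fun _ y => k y y) z z =
    iter D (iter D (fun x => k x x)) z.
  by apply: eq_iter => w; rewrite /comp2 /pow2 !(iter_fact_inj _ injg).
move=> x y eqxy; apply: inj; rewrite /= !sE -(prednK (fact_gt0 #|X|)).
by rewrite (iterSr _ _ x) (iterSr _ _ y) !(iterSr #|X|`!.-1 (fun x => k x x)) /= eqxy.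
Qed.

(** For an injective diagonal the [D]-th power is the identity, so this composes
    with the inverse of the diagonal. *)
Definition normalize2 (t : X -> X -> X) : X -> X -> X :=
  fun x y => iter D.-1 (fun z => t z z) (t x y).

Lemma normalize2_idem t : injective (fun x => t x x) -> idempotent2 (normalize2 t).
Proof.
move=> inj x; rewrite /normalize2 -(iterSr _ (fun z => t z z)).
by rewrite prednK ?fact_gt0 ?iter_fact_inj.
Qed.

Lemma cut_compatible_normalize f k g : cut_compatible (X := X) f k g ->
  cut_compatible (X := X) (normalize2 f) (normalize2 k) (normalize2 g).
Proof.
move=> h i U; suff H n : compatible (X := X) (i := i) (fun e x y =>
    iter n (fun z => cut_op f k g U (val e) z z) (cut_op f k g U (val e) x y)).
  apply: compatible_ext (H D.-1) => e x y.
  by rewrite /cut_op /normalize2; case: ifP => // _; case: ifP.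
elim: n => [|n IHn]; first exact: h.
exact: (compatible_subst (h i U) IHn IHn).
Qed.

Section Normalize.
Variable r : finType.

Definition normalize_fun (f : Pol X r) : {ffun power X r -> X} :=
  [ffun a => iter D.-1 (fun x => val f [ffun _ => x]) (val f a)].

Lemma normalize_is_hom (f : Pol X r) : is_hom (normalize_fun f).
Proof.
have /is_hom_powerP hf := valP f.
apply/is_hom_powerP => i s sR.
have sfR := hf i s sR.
suff H n : [ffun e => iter n (fun x => val f [ffun _ => x]) (val f [ffun j => s j e])]
    \in interp X i by apply: mem_ext (H D.-1) _ => e; rewrite !ffunE.
elim: n => [|n IHn]; first exact: sfR.
apply: mem_ext (hf i (fun _ => _) (fun _ => IHn)) _ => e; rewrite !ffunE.
by rewrite iterS; congr (val f _); apply/ffunP => j; rewrite !ffunE.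
Qed.

Definition normalize (f : Pol X r) : Pol X r := pol_of (normalize_is_hom f).

End Normalize.

Lemma normalize_natural (r s : finType) (u : r -> s) (f : Pol X r) :
  normalize (mmap u f) = mmap u (normalize f).
Proof.
apply/val_inj/ffunP => a; rewrite !ffunE; apply: eq_iter => x.
by rewrite ffunE; congr (val f _); apply/ffunP => j; rewrite !ffunE.
Qed.

Definition alpha_normalize (alpha : minion_hom (Pol X) id_minion) :
    minion_hom (Pol X) id_minion.
Proof.
exists (fun r f => alpha r (normalize f)) => r s u f.
by rewrite normalize_natural mhom_natural.
Defined.

End Core.

(** * Cut-homotopies as cuts of cliques *)

Section Homotopic.
Variables (C : choiceType) (F : seq (colored_clique C)).

Definition homotopic (X : structure (family_sig F)) (r : finType) (f g : Pol X r) :=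
  exists h : hom (product (power X r) (hat F P1)) X,
    (forall a, val h (a, P1_00) = val f a) /\
    (forall a, val h (a, P1_11) = val g a).

Definition P1_01 : edge P1 := @edge_of P1 ord0 ord_max isT.

(** A set of vertices of a clique is a graph homomorphism to [P1], since all loops
    are present there; this turns it into a tuple in the relation of the hat. *)
Lemma homotopy_cut_compatible (X : structure (family_sig F)) (r : finType)
    (h : hom (product (power X r) (hat F P1)) X) (u : r -> bool) :
  let op (e : edge P1) (x y : X) := val h ([ffun j => if u j then y else x], e) in
  cut_compatible (op P1_00) (op P1_01) (op P1_11).
Proof.
move=> op i U s t sR tR.
pose p : {ffun 'I_(val i) -> 'I_2} := [ffun v => if v \in U then ord_max else ord0].
pose cut (e : edge (clique (val i))) :=
  if val e \subset U then P1_11 else if [disjoint val e & U] then P1_00 else P1_01.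
have cutE e : val (cut e) = p @: val e.
  have /card_gt0P[v0 v0e] : 0 < #|val e| by rewrite card_clique_edge.
  apply/setP => b; apply/idP/imsetP.
    rewrite /cut; case: ifP => [/subsetP eU|/subsetPn[v ve vU]].
      rewrite !inE orbb => /eqP ->; exists v0 => //.
      by rewrite ffunE eU.
    case: ifP => [dU|/negbT].
      rewrite !inE orbb => /eqP ->; exists v0 => //.
      by rewrite ffunE (disjointFr dU).
    rewrite -setI_eq0 => /set0Pn[w]; rewrite inE => /andP[we wU].
    rewrite !inE => /orP[] /eqP ->; first by exists v; rewrite ?ffunE ?(negPf vU).
    by exists w; rewrite ?ffunE ?wU.
  case=> v ve ->; rewrite /cut ffunE.
  case eU: (val e \subset U).
    by rewrite (subsetP eU) // !inE eqxx.
  case dU: [disjoint val e & U]; first by rewrite (disjointFr dU) // !inE eqxx.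
  by case: ifP; rewrite !inE eqxx ?orbT.
have /is_homP/(_ i [ffun e => ([ffun j => if u j then t e else s e], cut e)]) := valP h.
move=> hR; apply: mem_ext (hR _) _ => [|e]; last first.
  by rewrite !ffunE /cut /cut_op /op; case: ifP => // _; case: ifP.
rewrite inE; apply/andP; split.
  rewrite inE; apply/forallP => j; case uj: (u j).
    by apply: mem_ext tR _ => e; rewrite !ffunE uj.
  by apply: mem_ext sR _ => e; rewrite !ffunE uj.
rewrite inE; apply/existsP; exists p; apply/andP; split.
  by apply/forallP => v; apply/forallP => w; rewrite implybT.
by apply/forallP => e; rewrite !ffunE cutE.
Qed.

(** If the images differ, identifying with each other all variables except the image
    of [g] gives a binary homotopy whose normalized ends still have different images. *)
Theorem core_collapse (X : structure (family_sig F)) :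
  (forall u : hom X X, injective (val u)) ->
  forall (alpha : minion_hom (Pol X) id_minion) (r : finType) (f g : Pol X r),
    homotopic f g -> alpha_normalize alpha r f = alpha_normalize alpha r g.
Proof.
move=> coreX alpha r f g [h [hf hg]] /=.
apply/eqP/contraT => neq.
pose u j := j == alpha r (normalize g).
have hcut := homotopy_cut_compatible h u.
set op := fun _ => _ in hcut; rewrite /= in hcut.
have hn := cut_compatible_normalize hcut.
have normE (e : edge P1) (k : Pol X r) : (forall a, val h (a, e) = val k a) ->
    alpha2 alpha (normalize2 (op e)) = u (alpha r (normalize k)).
  move=> hk; apply: alpha2_minor => x y; rewrite ffunE /normalize2 /op hk.
  apply: eq_iter => z; rewrite hk; congr (val k _).
  by apply/ffunP => j; rewrite !ffunE if_same.
have := cut_idempotent_alpha2 alpha hn.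
rewrite (normE _ f hf) (normE _ g hg) /u eqxx (negPf neq).
move=> H; have : false = true by apply: H; apply: normalize2_idem;
  [apply: (pol2_diag_inj coreX (cut_compatible_pol_l hcut))
  |apply: (cut_diag_inj coreX hcut)
  |apply: (pol2_diag_inj coreX (cut_compatible_pol_r hcut))].
by [].
Qed.

(** * Reduction to a core *)

Section Transport.
Variables (X Y : structure (family_sig F)) (p : hom Y X) (q : hom X Y).

Definition transport_fun (r : finType) (f : Pol X r) : {ffun power Y r -> Y} :=
  [ffun a : {ffun r -> Y} => val q (val f [ffun j => val p (a j)])].

Lemma transport_is_hom (r : finType) (f : Pol X r) : is_hom (transport_fun f).
Proof.
have /is_homP hp := valP p; have /is_homP hq := valP q.
have /is_hom_powerP hf := valP f.
apply/is_hom_powerP => i s sR.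
apply: mem_ext (hq i _ (hf i _ (fun j => hp i _ (sR j)))) _ => e.
rewrite !ffunE; congr (val q (val f _)).
by apply/ffunP => j; rewrite !ffunE.
Qed.

Definition transport (r : finType) (f : Pol X r) : Pol Y r :=
  pol_of (transport_is_hom f).

Lemma transport_natural (r s : finType) (u : r -> s) (f : Pol X r) :
  transport (mmap u f) = mmap u (transport f).
Proof.
apply/val_inj/ffunP => a; rewrite !ffunE; congr (val q (val f _)).
by apply/ffunP => j; rewrite !ffunE.
Qed.

Definition transport_hom : minion_hom (Pol X) (Pol Y) := MinionHom transport_natural.

Lemma homotopic_transport (r : finType) (f g : Pol X r) :
  homotopic f g -> homotopic (transport f) (transport g).
Proof.
case=> h [hf hg].
pose k : {ffun product (power Y r) (hat F P1) -> Y} :=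
  [ffun a : {ffun r -> Y} * edge P1 => val q (val h ([ffun j => val p (a.1 j)], a.2))].
have hk : is_hom k.
  have /is_homP hp := valP p; have /is_homP hq := valP q; have /is_homP hh := valP h.
  apply/is_homP => i s; rewrite inE => /andP[]; rewrite inE => /forallP s1 s2.
  have sR : [ffun e => ([ffun j => val p ((s e).1 j)], (s e).2)]
      \in interp (product (power X r) (hat F P1)) i.
    rewrite inE; apply/andP; split.
      rewrite inE; apply/forallP => j; apply: mem_ext (hp i _ (s1 j)) _ => e.
      by rewrite !ffunE.
    by apply: mem_ext s2 _ => e; rewrite !ffunE.
  by apply: mem_ext (hq i _ (hh i _ sR)) _ => e; rewrite !ffunE.
exists (exist (fun f => is_true (is_hom f)) k hk); split=> a; rewrite !ffunE.
  by rewrite hf.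
by rewrite hg.
Qed.

End Transport.

Section Comp.
Variables (M N P : minion) (b : minion_hom N P) (a : minion_hom M N).

Definition minion_hom_comp : minion_hom M P.
Proof.
exists (fun r x => b r (a r x)) => r s u x.
by rewrite !mhom_natural.
Defined.

End Comp.

Section Image.
Variables (X : structure (family_sig F)) (u : hom X X).

Definition image_structure : structure (family_sig F) :=
  @Structure (family_sig F) {x : X | x \in codom (val u)} (fun i =>
    [set s : {ffun arity i -> {x : X | x \in codom (val u)}} |
       [ffun e => val (s e)] \in interp X i]).

Lemma image_incl_is_hom :
  is_hom (X := image_structure) (Y := X) [ffun x => val x].
Proof.
apply/is_homP => i s; rewrite inE => sR; apply: mem_ext sR _ => e.
by rewrite !ffunE.
Qed.

Lemma image_proj_is_hom : is_hom (X := X) (Y := image_structure)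
  [ffun x => exist _ (val u x) (codom_f (val u) x)].
Proof.
have /is_homP hu := valP u.
apply/is_homP => i s sR; rewrite inE; apply: mem_ext (hu i _ sR) _ => e.
by rewrite !ffunE.
Qed.

Definition image_incl : hom image_structure X :=
  exist (fun f => is_true (is_hom f)) _ image_incl_is_hom.

Definition image_proj : hom X image_structure :=
  exist (fun f => is_true (is_hom f)) _ image_proj_is_hom.

Lemma card_image_structure : ~~ injectiveb (val u) -> #|image_structure| < #|X|.
Proof.
move=> ninj; rewrite card_sig ltn_neqAle.
rewrite (eq_card (B := mem (codom (val u)))) //.
rewrite leq_image_card andbT; apply: contra ninj => /image_injP inj.
by apply/injectiveP => x y; apply: inj.
Qed.

End Image.

(** Induction on the size: a non-injective endomorphism makes [X] equivalent to its
    smaller image. *)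
Theorem structure_collapse (X : structure (family_sig F)) :
  minion_hom (Pol X) id_minion ->
  exists alpha : minion_hom (Pol X) id_minion,
    forall (r : finType) (f g : Pol X r), homotopic f g -> alpha r f = alpha r g.
Proof.
have [n] := ubnP #|X|; elim: n X => // n IHn X leX alpha.
have [/existsP[u ninj]|] := boolP [exists u : hom X X, ~~ injectiveb (val u)].
  pose p := image_incl u; pose q := image_proj u.
  have ltY := leq_trans (card_image_structure ninj) leX.
  have [beta hbeta] := IHn _ ltY (minion_hom_comp alpha (transport_hom q p)).
  exists (minion_hom_comp beta (transport_hom p q)) => r f g fg /=.
  exact/hbeta/homotopic_transport.
move=> /existsPn inj; exists (alpha_normalize alpha) => r f g.
by apply: core_collapse => u; apply/injectiveP; have := inj u; rewrite negbK.
Qed.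

End Homotopic.

Theorem theorem5p1 (C : choiceType) (F : seq (colored_clique C)) :
  inhabited (minion_hom (Pol (family_structure F)) id_minion) ->
  exists alpha : minion_hom (Pol (family_structure F)) id_minion,
    forall (r : finType) (f g : Pol (family_structure F) r),
      cut_homotopic f g -> alpha r f = alpha r g.
Proof. by case=> alpha; apply: structure_collapse. Qed.
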